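(* Let $A,B\in\mathbb{C}^{n\times n}$ with $\mathrm{rk}(A)=r$ and $\mathrm{rk}(B)=s$ be written as $$A=U\begin{bmatrix}\Sigma_A A_1&\Sigma_A A_2\\0&0\end{bmatrix}V^*,\qquad B=V\begin{bmatrix}\Sigma_B B_1&\Sigma_B B_2\\0&0\end{bmatrix}U^*,$$ where $U,V\in\mathbb{C}^{n\times n}$ are unitary, $\Sigma_A\in\mathbb{C}^{r\times r}$ and $\Sigma_B\in\mathbb{C}^{s\times s}$ are diagonal positive definite matrices, and the blocks $A_1\in\mathbb{C}^{r\times s}$, $A_2\in\mathbb{C}^{r\times(n-s)}$, $B_1\in\mathbb{C}^{s\times r}$, $B_2\in\mathbb{C}^{s\times(n-r)}$ satisfy $A_1A_1^*+A_2A_2^*=I_r$ and $B_1B_1^*+B_2B_2^*=I_s$. Then: (a) $A^{(B)}=0$ if and only if $AB=0$; (b) $(A^{(B)})^\dagger=ABB^\dagger$; (c) $BB^\dagger A^{(B)}=A^{(B)}$; (d) $A^{(I)}=A^{(A^\dagger)}=A^\dagger$; (e) $A^{(A^{(B)})}=A^{(B)}$; (f) $(A^{(B)})^{([A^{(B)}]^\dagger)}=(A^{(B)})^\dagger$; (g) $AB=BA$ if and only if $[A^{(B)}]^\dagger B=[B^{(A)}]^\dagger A$; (h) $A^{(B)}=A^\dagger$ if and only if $A_2=0$.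
   Context: $M^*$, $\mathrm{rk}(M)$, $M^\dagger$ denote the conjugate transpose, rank and Moore-Penrose inverse of a complex matrix $M$; $I$ is the $n\times n$ identity matrix. For any $C,D\in\mathbb{C}^{n\times n}$, the generalized inverse of $C$ with respect to $D$ is $C^{(D)}:=(CDD^\dagger)^\dagger$. *)

(* Defs.v *)
From mathcomp Require Import all_boot all_order all_algebra.
From mathcomp Require Export spectral.

Set Implicit Arguments.
Unset Strict Implicit.
Unset Printing Implicit Defensive.

Import Order.TTheory GRing.Theory Num.Theory.
Local Open Scope ring_scope.
Local Open Scope sesquilinear_scope.

Definition penrose (C : numClosedFieldType)
    m n (M : 'M[C]_(m, n)) (X : 'M[C]_(n, m)) : bool :=
  [&& M *m X *m M == M, X *m M *m X == X,
      (M *m X) ^t* == M *m X & (X *m M) ^t* == X *m M].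

Lemma trmxC_mul (C : numClosedFieldType)
    m n p (M : 'M[C]_(m, n)) (N : 'M[C]_(n, p)) :
  (M *m N) ^t* = N ^t* *m M ^t*.
Proof. by rewrite trmx_mul map_mxM. Qed.

Lemma row_mul_trmxC_eq0 (C : numClosedFieldType)
    n (v : 'rV[C]_n) : v *m v ^t* = 0 -> v = 0.
Proof.
move/matrixP/(_ 0 0); rewrite !mxE => /eqP.
rewrite psumr_eq0 => [|i _]; last by rewrite !mxE mul_conjC_ge0.
move=> /allP v0; apply/rowP => i; rewrite mxE.
have := v0 i (mem_index_enum _).
by rewrite !mxE mul_conjC_eq0 => /eqP.
Qed.

Lemma row_free_gram_unit (C : numClosedFieldType) m n (M : 'M[C]_(m, n)) :
  row_free M -> M *m M ^t* \in unitmx.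
Proof.
move=> Mfree; rewrite -row_free_unit; apply/row_freeP/row_freeP/inj_row_free.
move=> v v0; apply: (row_free_inj Mfree); rewrite mul0mx.
by apply: row_mul_trmxC_eq0; rewrite trmxC_mul mulmxA -(mulmxA v) v0 mul0mx.
Qed.

Lemma penrose_ex (C : numClosedFieldType)
    m n (M : 'M[C]_(m, n)) : exists X, penrose M X.
Proof.
suff ex_fact k (L : 'M[C]_(m, k)) (R : 'M[C]_(k, n)) :
    row_full L -> row_free R -> exists X, penrose (L *m R) X.
  rewrite -[X in penrose X](mulmx_base M).
  by apply: ex_fact; [apply: col_base_full | apply: row_base_free].
move=> Lfull Rfree; have GR := row_free_gram_unit Rfree.
have GL : L ^t* *m L \in unitmx.
  rewrite -{2}(trmxCK L); apply: row_free_gram_unit.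
  by rewrite /row_free mxrank_map mxrank_tr.
pose P := R ^t* *m invmx (R *m R ^t*); pose Q := invmx (L ^t* *m L) *m L ^t*.
have RP : R *m P = 1%:M by rewrite mulmxA mulmxV.
have QL : Q *m L = 1%:M by rewrite -mulmxA mulVmx.
have MX : L *m R *m (P *m Q) = L *m Q.
  by rewrite mulmxA -(mulmxA L) RP mulmx1.
have XM : P *m Q *m (L *m R) = P *m R.
  by rewrite mulmxA -(mulmxA P) QL mulmx1.
have invC (A : 'M[C]_k) : (invmx A) ^t* = invmx (A ^t*).
  by rewrite trmx_inv map_invmx.
exists (P *m Q); rewrite /penrose MX XM; apply/and4P; split; apply/eqP.
- by rewrite mulmxA -(mulmxA L Q) QL mulmx1.
- by rewrite mulmxA -(mulmxA P R) RP mulmx1.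
- by rewrite /Q !trmxC_mul invC trmxC_mul !trmxCK mulmxA.
- by rewrite /P !trmxC_mul invC trmxC_mul !trmxCK mulmxA.
Qed.

Lemma penrose_uniq (C : numClosedFieldType) m n (M : 'M[C]_(m, n)) X Y :
  penrose M X -> penrose M Y -> X = Y.
Proof.
move=> /and4P[/eqP X1 /eqP X2 /eqP X3 /eqP X4].
move=> /and4P[/eqP Y1 /eqP Y2 /eqP Y3 /eqP Y4].
have eqMX : M *m X = M *m Y.
  by rewrite -X3 -{1}Y1 -[M *m Y *m M *m X]mulmxA trmxC_mul X3 Y3 !mulmxA X1.
have eqXM : X *m M = Y *m M.
  rewrite -X4 -{1}Y1 -[M *m Y *m M]mulmxA [X *m _]mulmxA trmxC_mul X4 Y4.
  by rewrite -!mulmxA (mulmxA M) X1.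
by rewrite -X2 eqXM -mulmxA eqMX mulmxA Y2.
Qed.

Definition mpinv (C : numClosedFieldType)
    m n (M : 'M[C]_(m, n)) : 'M[C]_(n, m) :=
  xchoose (penrose_ex M).

Lemma mpinvP (C : numClosedFieldType)
    m n (M : 'M[C]_(m, n)) : penrose M (mpinv M).
Proof. exact: xchooseP. Qed.

Definition geninv (C : numClosedFieldType)
    n (A D : 'M[C]_n) : 'M[C]_n := mpinv (A *m D *m mpinv D).

Definition posdefmx (C : numClosedFieldType) n (M : 'M[C]_n) : Prop :=
  M \is hermsymmx /\
  forall x : 'cV[C]_n, x != 0 -> 0 < (x ^t* *m M *m x) 0 0.

(* Used to cast (r + (n - r)) x (s + (n - s)) block matrices to size n x n. *)
Lemma rank_subnKC (C : numClosedFieldType)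
    n (M : 'M[C]_n) r : \rank M = r -> (r + (n - r))%N = n.
Proof. by move=> <-; rewrite subnKC ?rank_leq_row. Qed.

(* Main.v *)
Require Import Defs.
From mathcomp Require Import all_boot all_order all_algebra.
From mathcomp Require Import reals complex.

Set Implicit Arguments.
Unset Strict Implicit.
Unset Printing Implicit Defensive.

Import Order.TTheory GRing.Theory Num.Theory.
Local Open Scope ring_scope.
Local Open Scope complex_scope.
Local Open Scope sesquilinear_scope.

(** Put P_B = B B^+, the orthogonal projector onto the range of B, so that
    A^(B) = (A P_B)^+.  Since the pseudoinverse is an involution, the
    pseudoinverse of A^(B) is A P_B again; and the range of A^(B), being that of
    (A P_B)^* = P_B A^*, lies in the range of B ([geninv_range]).  Parts (a)-(g)
    are formal consequences of these two facts: for instance (g) holds because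
    (A^(B))^+ B = A P_B B = A B and, likewise, (B^(A))^+ A = B A.

    Part (h) is the only one about the block form.  By injectivity of the
    pseudoinverse it says that A P_B = A iff A_2 = 0.  As the s nonzero rows of
    the middle factor of B are independent, the range of B is spanned by the
    first s columns of V, hence P_B = V diag(I_s, 0) V^* ([block_range_proj]);
    multiplying A by this projector on the right erases exactly the block
    Sigma_A A_2, and Sigma_A is invertible ([block_proj_fix]). *)

Lemma penrose_sym (C : numClosedFieldType) m n
    (M : 'M[C]_(m, n)) (X : 'M[C]_(n, m)) :
  penrose M X -> penrose X M.
Proof. by case/and4P=> M1 M2 M3 M4; apply/and4P; split. Qed.

Lemma mpinvK (C : numClosedFieldType) m n (M : 'M[C]_(m, n)) :
  mpinv (mpinv M) = M.
Proof.
by apply: (penrose_uniq (mpinvP (mpinv M))); apply: penrose_sym; apply: mpinvP.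
Qed.

Lemma mpinv0 (C : numClosedFieldType) m n :
  mpinv (0 : 'M[C]_(m, n)) = 0.
Proof.
apply: (penrose_uniq (mpinvP _)).
by rewrite /penrose !mulmx0 !trmx0 !map_mx0 !eqxx.
Qed.

Lemma mpinv_eq0 (C : numClosedFieldType) m n (M : 'M[C]_(m, n)) :
  mpinv M = 0 -> M = 0.
Proof. by move=> M0; rewrite -(mpinvK M) M0 mpinv0. Qed.

Lemma mulmx_mpinvK (C : numClosedFieldType) m n (M : 'M[C]_(m, n)) :
  M *m mpinv M *m M = M.
Proof. by case/and4P: (mpinvP M) => /eqP. Qed.

Lemma mpinv_mulmxK (C : numClosedFieldType) m n (M : 'M[C]_(m, n)) :
  mpinv M *m M *m mpinv M = mpinv M.
Proof. by case/and4P: (mpinvP M) => _ /eqP. Qed.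

Lemma mulmx_mpinv_herm (C : numClosedFieldType) m n (M : 'M[C]_(m, n)) :
  (M *m mpinv M) ^t* = M *m mpinv M.
Proof. by case/and4P: (mpinvP M) => _ _ /eqP. Qed.

(** An orthogonal projector is determined by its range: two Hermitian matrices
    that fix each other's columns are equal, as one sees by taking adjoints. *)
Lemma range_proj_uniq (C : numClosedFieldType) m n (M : 'M[C]_(m, n))
    (P : 'M[C]_m) (Y : 'M[C]_(n, m)) :
  P ^t* = P -> P *m M = M -> P = M *m Y -> M *m mpinv M = P.
Proof.
move=> Pherm PM PE.
have MMP : M *m mpinv M *m P = P by rewrite PE mulmxA mulmx_mpinvK.
by rewrite -mulmx_mpinv_herm -{1}PM -mulmxA trmxC_mul Pherm
           mulmx_mpinv_herm MMP.
Qed.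

(** The range of X^+ is that of X^*, because X^+ = (X^+ X)^* X^+; so a Hermitian
    matrix absorbed by X on the right is absorbed by X^+ on the left. *)
Lemma mulmx_mpinv_absorb (C : numClosedFieldType) m n (X : 'M[C]_(m, n))
    (P : 'M[C]_n) :
  P ^t* = P -> X *m P = X -> P *m mpinv X = mpinv X.
Proof.
move=> Pherm XP; case/and4P: (mpinvP X) => _ /eqP X2 _ /eqP X4.
by rewrite -{1}X2 -X4 mulmxA -{1}Pherm -trmxC_mul -mulmxA XP X4.
Qed.

Lemma mpinv_geninv (C : numClosedFieldType) n (A B : 'M[C]_n) :
  mpinv (geninv A B) = A *m B *m mpinv B.
Proof. exact: mpinvK. Qed.

Lemma geninv_range (C : numClosedFieldType) n (A B : 'M[C]_n) :
  B *m mpinv B *m geninv A B = geninv A B.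
Proof.
apply: mulmx_mpinv_absorb; first exact: mulmx_mpinv_herm.
by rewrite -!mulmxA (mulmxA (mpinv B)) mpinv_mulmxK.
Qed.

Lemma geninv_eq0 (C : numClosedFieldType) n (A B : 'M[C]_n) :
  geninv A B = 0 <-> A *m B = 0.
Proof.
split=> [/mpinv_eq0 AP0|AB0]; last by rewrite /geninv AB0 mul0mx mpinv0.
by rewrite -(mulmx_mpinvK B) !mulmxA AP0 mul0mx.
Qed.

Lemma geninv1 (C : numClosedFieldType) n (A : 'M[C]_n) :
  geninv A 1%:M = mpinv A.
Proof.
by rewrite /geninv -mulmxA -[1%:M *m _]mulmx1 mulmx_mpinvK mulmx1.
Qed.

Lemma geninv_mpinv (C : numClosedFieldType) n (A : 'M[C]_n) :
  geninv A (mpinv A) = mpinv A.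
Proof. by rewrite /geninv mpinvK mulmx_mpinvK. Qed.

(** With G = A^(B), one has G^+ = A P_B and, by the inclusion of the range of G
    in that of B, A G = A P_B G; hence A G G^+ = (A P_B) G (A P_B) = A P_B. *)
Lemma geninv_geninv (C : numClosedFieldType) n (A B : 'M[C]_n) :
  geninv A (geninv A B) = geninv A B.
Proof.
suff AGG : A *m geninv A B *m (A *m B *m mpinv B) = A *m B *m mpinv B.
  by rewrite [LHS]/geninv mpinv_geninv AGG.
rewrite -{1}geninv_range !(mulmxA A).
exact: mulmx_mpinvK.
Qed.

Lemma mpinv_geninv_mul (C : numClosedFieldType) n (A B : 'M[C]_n) :
  mpinv (geninv A B) *m B = A *m B.
Proof. by rewrite mpinv_geninv -!mulmxA (mulmxA B) mulmx_mpinvK. Qed.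

Lemma geninv_comm (C : numClosedFieldType) n (A B : 'M[C]_n) :
  A *m B = B *m A <->
    mpinv (geninv A B) *m B = mpinv (geninv B A) *m A.
Proof.
have AB := mpinv_geninv_mul A B; have BA := mpinv_geninv_mul B A.
split=> comm; first exact: (etrans AB (etrans comm (esym BA))).
exact: (etrans (esym AB) (etrans comm BA)).
Qed.

Lemma geninv_eq_mpinv (C : numClosedFieldType) n (A B : 'M[C]_n) :
  geninv A B = mpinv A <-> A *m (B *m mpinv B) = A.
Proof.
rewrite mulmxA /geninv; split=> [eqAB|->] //.
by rewrite -[LHS]mpinvK eqAB mpinvK.
Qed.

Lemma posdefmx_unit (C : numClosedFieldType) n (M : 'M[C]_n) :
  posdefmx M -> M \in unitmx.
Proof.
case=> _ Mpos; rewrite -unitmx_tr -row_free_unit.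
apply/row_freeP/row_freeP/inj_row_free => v vM0.
apply/eqP; apply/negP => /negP v0.
have /Mpos : v^T != 0 by rewrite trmx_eq0.
by rewrite -mulmxA -[M *m _]trmxK trmx_mul trmxK vM0 trmx0 mulmx0 mxE ltxx.
Qed.

Lemma unitarymx_mulVC (C : numClosedFieldType) n (V : 'M[C]_n) :
  V \is unitarymx -> V ^t* *m V = 1%:M.
Proof. by move/unitarymxP/mulmx1C. Qed.

(** The dimensions m and n are kept apart, although the application has m = n,
    so that both index equalities can be eliminated independently. *)
Lemma block_range_proj (C : numClosedFieldType) m n p q k l
    (eqm : (p + q)%N = m) (eqn : (k + l)%N = n)
    (V : 'M[C]_m) (U : 'M[C]_n) (S : 'M[C]_p)
    (N1 : 'M[C]_(p, k)) (N2 : 'M[C]_(p, l)) :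
  V \is unitarymx -> U \is unitarymx -> S \in unitmx ->
  N1 *m N1 ^t* + N2 *m N2 ^t* = 1%:M ->
  let M := V *m castmx (eqm, eqn) (block_mx (S *m N1) (S *m N2) 0 0)
             *m U ^t* in
  M *m mpinv M = V *m castmx (eqm, eqm) (block_mx 1%:M 0 0 0) *m V ^t*.
Proof.
case: m / eqm V; case: n / eqn U => U V uV uU uS N12 /=.
rewrite !castmx_id.
(* A right inverse of the row block S [N1 N2] is [N1 N2]^* S^-1. *)
pose Y := U *m block_mx (N1 ^t* *m invmx S) 0 (N2 ^t* *m invmx S) 0 *m V ^t*.
apply: (range_proj_uniq (Y := Y)).
- rewrite !trmxC_mul trmxCK -mulmxA tr_block_mx map_block_mx.
  by rewrite !trmx0 !map_mx0 trmx1 map_mx1 mulmxA.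
- rewrite !mulmxA -(mulmxA _ (V ^t*)) unitarymx_mulVC // mulmx1.
  rewrite -(mulmxA V) mulmx_block.
  by rewrite !mul1mx !mul0mx !addr0.
- rewrite /Y !mulmxA -(mulmxA _ (U ^t*)) unitarymx_mulVC // mulmx1.
  rewrite -[in RHS](mulmxA V) mulmx_block.
  rewrite !mulmx0 !mul0mx !addr0 !mulmxA -mulmxDl.
  by rewrite -!(mulmxA S) -mulmxDr N12 mulmx1 mulmxV.
Qed.

(** Right multiplication by V diag(I, 0) V^* deletes the second column block. *)
Lemma block_proj_fix (C : numClosedFieldType) m n p q k l
    (eqm : (p + q)%N = m) (eqn : (k + l)%N = n)
    (U : 'M[C]_m) (V : 'M[C]_n) (S : 'M[C]_p)
    (N1 : 'M[C]_(p, k)) (N2 : 'M[C]_(p, l)) :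
  U \is unitarymx -> V \is unitarymx -> S \in unitmx ->
  let M := U *m castmx (eqm, eqn) (block_mx (S *m N1) (S *m N2) 0 0)
             *m V ^t* in
  M *m (V *m castmx (eqn, eqn) (block_mx 1%:M 0 0 0) *m V ^t*) = M <-> N2 = 0.
Proof.
case: m / eqm U; case: n / eqn V => V U uU uV uS /=.
rewrite !castmx_id.
rewrite !mulmxA -(mulmxA _ (V ^t*)) unitarymx_mulVC // mulmx1.
rewrite -(mulmxA U) mulmx_block !mulmx1 !mulmx0 !addr0.
split=> [eqM|->]; last by rewrite mulmx0.
have /eq_block_mx[_ SN2 _ _] :
    block_mx (S *m N1) 0 0 0 = block_mx (S *m N1) (S *m N2) 0 0
      :> 'M_(p + q, k + l).
  have /(congr1 (fun Z => U ^t* *m Z *m V)) := eqM.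
  rewrite !mulmxA unitarymx_mulVC // !mul1mx.
  by rewrite -!(mulmxA _ (V ^t*)) unitarymx_mulVC // !mulmx1.
by rewrite -[N2](mulKmx uS) -SN2 mulmx0.
Qed.

Lemma geninv_eq_mpinv_block (C : numClosedFieldType) n r s k l
    (eqr : (r + k)%N = n) (eqs : (s + l)%N = n)
    (A B U V : 'M[C]_n) (SA : 'M[C]_r) (SB : 'M[C]_s)
    (A1 : 'M[C]_(r, s)) (A2 : 'M[C]_(r, l))
    (B1 : 'M[C]_(s, r)) (B2 : 'M[C]_(s, k)) :
  U \is unitarymx -> V \is unitarymx -> SA \in unitmx -> SB \in unitmx ->
  B1 *m B1 ^t* + B2 *m B2 ^t* = 1%:M ->
  A = U *m castmx (eqr, eqs) (block_mx (SA *m A1) (SA *m A2) 0 0)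
        *m V ^t* ->
  B = V *m castmx (eqs, eqr) (block_mx (SB *m B1) (SB *m B2) 0 0)
        *m U ^t* ->
  geninv A B = mpinv A <-> A2 = 0.
Proof.
move=> uU uV uSA uSB B12 AE BE.
apply: (iff_trans (geninv_eq_mpinv A B)).
have -> : B *m mpinv B =
    V *m castmx (eqs, eqs) (block_mx 1%:M 0 0 0) *m V ^t*.
  by rewrite [in LHS]BE; apply: block_range_proj.
have := block_proj_fix eqr eqs A1 A2 uU uV uSA.
by rewrite /= -AE.
Qed.

Theorem theorem3p3 (R : realType) (n r s : nat) (A B U V : 'M[R[i]]_n)
    (SA : 'M[R[i]]_r) (SB : 'M[R[i]]_s)
    (A1 : 'M[R[i]]_(r, s)) (A2 : 'M[R[i]]_(r, n - s))
    (B1 : 'M[R[i]]_(s, r)) (B2 : 'M[R[i]]_(s, n - r))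
    (rkA : \rank A = r) (rkB : \rank B = s)
    (Uunitary : U \is unitarymx) (Vunitary : V \is unitarymx)
    (SAdiag : is_diag_mx SA) (SApos : posdefmx SA)
    (SBdiag : is_diag_mx SB) (SBpos : posdefmx SB)
    (A12 : A1 *m A1 ^t* + A2 *m A2 ^t* = 1%:M)
    (B12 : B1 *m B1 ^t* + B2 *m B2 ^t* = 1%:M)
    (AE : A = U *m castmx (rank_subnKC rkA, rank_subnKC rkB)
                     (block_mx (SA *m A1) (SA *m A2) 0 0) *m V ^t*)
    (BE : B = V *m castmx (rank_subnKC rkB, rank_subnKC rkA)
                     (block_mx (SB *m B1) (SB *m B2) 0 0) *m U ^t*) :
  (geninv A B = 0 <-> A *m B = 0) /\
  (mpinv (geninv A B) = A *m B *m mpinv B) /\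
  (B *m mpinv B *m geninv A B = geninv A B) /\
  (geninv A 1%:M = geninv A (mpinv A) /\ geninv A (mpinv A) = mpinv A) /\
  (geninv A (geninv A B) = geninv A B) /\
  (geninv (geninv A B) (mpinv (geninv A B)) = mpinv (geninv A B)) /\
  (A *m B = B *m A <->
     mpinv (geninv A B) *m B = mpinv (geninv B A) *m A) /\
  (geninv A B = mpinv A <-> A2 = 0).
Proof.
split; first exact: geninv_eq0.
split; first exact: mpinv_geninv.
split; first exact: geninv_range.
split; first by rewrite geninv1 geninv_mpinv.
split; first exact: geninv_geninv.
split; first exact: geninv_mpinv.
split; first exact: geninv_comm.
have uSA := posdefmx_unit SApos; have uSB := posdefmx_unit SBpos.
exact: (geninv_eq_mpinv_block Uunitary Vunitary uSA uSB B12 AE BE).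
Qed.
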